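(* Let $G$ be a simple graph of order $n$ and let $k$ be an integer with $0\le k\le n-1$. Then the number of vertices of $G$ of degree $k$ equals $[xy^{n-k}]\,da(G;x,y)$. Hence the degree sequence of $G$ is determined by $da(G;x,y)$.
   Context: All graphs are finite, simple and have at least one vertex. For a graph $G$, $S\subseteq V(G)$ and $u\in V(G)$, let $\bar S=V(G)\setminus S$, let $\delta_S(u)=|\{v\in S:\{u,v\}\in E(G)\}|$, and let $G[S]$ be the subgraph induced by $S$. The defensive alliance polynomial of $G$ is $$da(G;x,y)=\sum_{S} x^{|S|}\,y^{f_y(S)},\qquad f_y(S)=\min_{u\in S}\bigl(\delta_S(u)-\delta_{\bar S}(u)+|V(G)|\bigr),$$ where the sum runs over all non-empty $S\subseteq V(G)$ such that $G[S]$ is connected (single-vertex graphs are connected). $[x^ky^l]\,da(G;x,y)$ denotes the coefficient of $x^ky^l$ in $da(G;x,y)$. *)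

(* Defs.v *)
(* MathComp world, with multinomials for bivariate polynomials. *)
From HB Require Import structures.
From mathcomp Require Import all_boot all_order all_algebra.
From mathcomp Require Import mpoly.

Set Implicit Arguments.
Unset Strict Implicit.
Unset Printing Implicit Defensive.

Import GRing.Theory.

Record sgraph := SGraph {
  vertex :> finType;
  adj : rel vertex;
  adj_sym : ssrbool.symmetric adj;
  adj_irr : irreflexive adj
}.

Definition degree (G : sgraph) (v : G) : nat := #|[set w : G | adj v w]|.

Definition degree_sequence (G : sgraph) : seq nat :=
  sort geq [seq degree v | v : G].

Definition connected (G : sgraph) : bool :=
  [forall u : G, forall v : G, connect (@adj G) u v].

Section Induced.
Variables (G : sgraph) (S : {set G}).

Definition induced_adj : rel {x : G | x \in S} :=
  fun u v => adj (val u) (val v).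

Lemma induced_sym : ssrbool.symmetric induced_adj.
Proof. by move=> u v; apply: adj_sym. Qed.

Lemma induced_irr : irreflexive induced_adj.
Proof. by move=> u; apply: adj_irr. Qed.

Definition induced : sgraph := SGraph induced_sym induced_irr.

End Induced.

Section Exponent.
Variables (G : sgraph) (S : {set G}).

Definition delta (A : {set G}) (u : G) : nat := #|[set v in A | adj u v]|.

(* The addition is done first, so that the natural number subtraction is never
   truncated; see shifted_marginE. *)
Definition shifted_margin (u : G) : nat := delta S u + #|G| - delta (~: S) u.

(* The default value exceeds every shifted margin (shifted_margin_lt), so it
   plays no role for nonempty S; see fy_le and fy_attained. *)
Definition fy : nat := \big[minn/#|G|.*2]_(u in S) shifted_margin u.

Lemma shifted_marginE u :
  ((shifted_margin u)%:Z = (delta S u)%:Z - (delta (~: S) u)%:Z + #|G|%:Z)%R.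
Proof.
rewrite /shifted_margin -subzn ?PoszD 1?addrAC //.
exact: leq_trans (max_card _) (leq_addl _ _).
Qed.

Lemma shifted_margin_lt u : shifted_margin u < #|G|.*2.
Proof.
apply: leq_ltn_trans (leq_subr _ _) _.
rewrite -addnn ltn_add2r; apply: proper_card.
apply/properP; split; first by apply/subsetP.
by exists u; rewrite // inE adj_irr andbF.
Qed.

Lemma fy_le u : u \in S -> fy <= shifted_margin u.
Proof.
move=> uS; rewrite /fy; have := mem_index_enum u.
elim: (index_enum _) => //= v s IHs; rewrite big_cons inE.
case/predU1P=> [<-|/IHs le_u]; first by rewrite uS geq_minl.
by case: ifP => // _; apply: leq_trans (geq_minr _ _) le_u.
Qed.

Lemma fy_attained : S != set0 -> exists2 u, u \in S & fy = shifted_margin u.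
Proof.
case/set0Pn=> u0 u0S.
have [m_ge|//] : fy = #|G|.*2 \/ exists2 u, u \in S & fy = shifted_margin u.
  rewrite /fy; elim/big_rec: _ => [|u m uS IH]; first by left.
  by case: (leqP (shifted_margin u) m) => _ //; right; exists u.
by have := leq_ltn_trans (fy_le u0S) (shifted_margin_lt u0); rewrite m_ge ltnn.
Qed.

End Exponent.

(* The variables x and y are 'X_0 and 'X_1. *)
Definition da (G : sgraph) : {mpoly int[2]} :=
  (\sum_(S : {set G} | (S != set0) && connected (induced S))
     'X_(0 : 'I_2) ^+ #|S| * 'X_(1 : 'I_2) ^+ fy S)%R.

Definition coef_xy (p : {mpoly int[2]}) (k l : nat) : int :=
  (p@_[multinom [tuple k; l]])%R.

(* Main.v *)
(* A singleton {v} is connected and contributes x y^(n - deg v), so the part of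
   da(G;x,y) of degree 1 in x lists the numbers n - deg v.  Its value at y = 1
   is n, so n itself, and with it the degrees, can be read off. *)
Require Import Defs.
From mathcomp Require Import all_boot all_order all_algebra.
From mathcomp Require Import mpoly.

Set Implicit Arguments.
Unset Strict Implicit.
Unset Printing Implicit Defensive.

Import GRing.Theory.

Lemma mcoeff_monomial_xy (a b k l : nat) :
  coef_xy ('X_(0 : 'I_2) ^+ a * 'X_(1 : 'I_2) ^+ b)%R k l
    = (((a == k) && (b == l))%:R)%R.
Proof.
rewrite /coef_xy !mpolyXn -mpolyXD mcoeffX; congr ((nat_of_bool _)%:R)%R.
apply/eqP/andP => [E | [/eqP-> /eqP->]].
  (* Evaluating both exponent vectors at [ord0] and [ord_max], the indices of x and y, separates the
     two exponents. *)
  have /= := congr1 (fun m : 'X_{1..2} => (m ord0, m ord_max)) E.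
  rewrite !mnmDE !mulmnE !mnm1E !multinomE !(tnth_nth 0%N) /=.
  by rewrite !mul0n !mul1n addn0 add0n => -[-> ->].
apply/mnmP => i; rewrite mnmDE !mulmnE !mnm1E multinomE (tnth_nth 0%N).
by case: i => [[|[|//]] lt_i2]; rewrite /= !mul0n !mul1n ?addn0.
Qed.

(** Each admissible set contributes one monomial with coefficient 1, so nothing cancels and every
    coefficient is a cardinality. *)
Lemma coef_xy_da (G : sgraph) (k l : nat) :
  coef_xy (da G) k l =
  Posz #|[set S : {set G} | [&& S != set0, connected (induced S),
                                #|S| == k & fy S == l]]|.
Proof.
transitivity (\sum_(S : {set G} | (S != set0) && connected (induced S))
    (((#|S| == k) && (fy S == l))%:R : int))%R.
  rewrite /coef_xy /da raddf_sum; apply: eq_bigr => S _.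
  exact: mcoeff_monomial_xy.
rewrite -natr_sum natz -big_mkcondr -sum1dep_card; congr Posz.
by apply: eq_bigl => S; rewrite -!andbA.
Qed.

Lemma degree_lt (G : sgraph) (v : G) : degree v < #|G|.
Proof.
apply: proper_card; apply/properP; split; first exact/subsetP.
by exists v; rewrite // inE adj_irr.
Qed.

Lemma connected_induced1 (G : sgraph) (v : G) : connected (induced [set v]).
Proof.
apply/forallP => -[x xv]; apply/forallP => -[y yv].
(* Two elements of the subtype over a singleton coincide, so the empty path joins them. *)
suff -> : exist _ x xv = exist _ y yv :> {x | x \in [set v]} by exact: connect0.
by apply: val_inj; move: (xv) (yv); rewrite /= !inE => /eqP-> /eqP->.
Qed.

(** The minimum has [v] as its only candidate, and irreflexivity puts every neighbour of [v] outside
    the singleton. *)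
Lemma fy1 (G : sgraph) (v : G) : fy [set v] = #|G| - degree v.
Proof.
have /fy_attained[u] : [set v] != set0 by apply/set0Pn; exists v; rewrite set11.
rewrite inE => /eqP-> ->; rewrite /shifted_margin.
have -> : delta [set v] v = 0.
  apply: eq_card0 => w; rewrite !inE.
  by case: eqP => [->|//]; rewrite adj_irr.
congr (_ - _); apply: eq_card => w; rewrite !inE.
by case: eqP => [->|//]; rewrite adj_irr.
Qed.

Lemma coef_xy_da1 (G : sgraph) (l : nat) :
  coef_xy (da G) 1 l = Posz #|[set v : G | #|G| - degree v == l]|.
Proof.
rewrite coef_xy_da; congr Posz; rewrite -[RHS](card_imset _ set1_inj).
apply: eq_card => S; rewrite inE; apply/and4P/imsetP => [[_ _]|[v]].
  by move=> /cards1P[v ->]; rewrite fy1 => fv; exists v; rewrite ?inE.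
rewrite inE => fv ->; split; rewrite ?cards1 ?fy1 ?connected_induced1 //.
by apply/set0Pn; exists v; rewrite set11.
Qed.

(** Truncated subtraction from [#|G|] is injective on numbers up to [#|G|], a range that contains
    both [k] and all degrees. *)
Lemma card_degree_eq (G : sgraph) (k : nat) : k <= #|G| ->
  Posz #|[set v : G | degree v == k]| = coef_xy (da G) 1 (#|G| - k).
Proof.
move=> le_k; rewrite coef_xy_da1; congr Posz; apply: eq_card => v; rewrite !inE.
by rewrite eqn_sub2lE // ltnW ?degree_lt.
Qed.

(** Each vertex is counted by exactly one coefficient, that of exponent [#|G| - degree v]. The bound
    [N] is left free so that two graphs can be compared over one range before their orders are known
    to agree. *)
Lemma order_eq_sum_coef (G : sgraph) (N : nat) : #|G| <= N ->
  Posz #|G| = (\sum_(l < N.+1) coef_xy (da G) 1 l)%R.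
Proof.
move=> leGN; under eq_bigr do rewrite coef_xy_da1.
have ltN (v : G) : #|G| - degree v < N.+1.
  by rewrite ltnS (leq_trans (leq_subr _ _)).
rewrite -[in LHS]sum1_card (partition_big (fun v => Ordinal (ltN v)) predT) //=.
under eq_bigr => l _ do rewrite sum1dep_card.
by rewrite -natz natr_sum; apply: eq_bigr => l _; rewrite natz.
Qed.

Lemma da_order (G H : sgraph) : da G = da H -> #|G| = #|H|.
Proof.
move=> eq_da; have [leG leH] := (leq_maxl #|G| #|H|, leq_maxr #|G| #|H|).
have := order_eq_sum_coef leG.
by rewrite eq_da -(order_eq_sum_coef leH) => -[].
Qed.

Lemma count_degree (G : sgraph) (k : nat) :
  count_mem k [seq degree v | v : G] = #|[set v : G | degree v == k]|.
Proof.
rewrite count_map cardE size_filter enumT.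
by apply: eq_count => v; rewrite /= inE.
Qed.

Lemma da_degree_sequence (G H : sgraph) :
  da G = da H -> degree_sequence G = degree_sequence H.
Proof.
move=> eq_da; have eq_order := da_order eq_da.
(* Sorting forgets only the order, so it suffices to compare the multiplicity of each value [k]. *)
apply/perm_sortP.
- by move=> m n; apply: leq_total.
- by move=> m n p le_mn le_pm; apply: leq_trans le_pm le_mn.
- by move=> m n; rewrite andbC => /anti_leq.
apply/allP => k _ /=; rewrite !count_degree.
(* Up to the common order the multiplicity is a coefficient of [da]; above it, [#|G| - k] would
   truncate to 0, but no vertex has such a degree. *)
have [le_k|lt_k] := leqP k #|G|.
  have := card_degree_eq le_k.
  by rewrite eq_da eq_order -card_degree_eq -?eq_order // => -[->].
have card0 (K : sgraph) : #|K| < k -> #|[set v : K | degree v == k]| = 0.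
  move=> lt_Kk; apply: eq_card0 => v; rewrite !inE.
  by rewrite ltn_eqF // (ltn_trans (degree_lt v)).
by rewrite !card0 -?eq_order.
Qed.

Theorem proposition12 (G : sgraph) (n : nat) (n_gt0 : 0 < n)
    (orderG : #|G| = n) :
  (forall k : nat, k <= n.-1 ->
     Posz #|[set v : G | degree v == k]| = coef_xy (da G) 1 (n - k))
  /\
  (forall H : sgraph, 0 < #|H| -> da G = da H ->
     degree_sequence G = degree_sequence H).
Proof.
split=> [k le_k|H _]; last exact: da_degree_sequence.
by rewrite -orderG card_degree_eq // orderG (leq_trans le_k) ?leq_pred.
Qed.
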